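(* For a meet-semilattice $A$, the following are equivalent. (1) $MA$ is a frame. (2) $MA=D_\infty A$. (3) $k=j=\delta$, where $k=k^A_{\mathcal{D}A}$ and $j=j^A_{\mathcal{D}A}$. (4) $\langle a,b\rangle$ is a normal ideal of $A$ for each $a,b\in A$.
   Context: A meet-semilattice is a poset with binary meets (not necessarily bounded). $\mathcal{D}A$ is the frame of all downsets of $A$ (including $\varnothing$) ordered by inclusion, and $A$ is identified with $\{{\downarrow}a: a\in A\}\subseteq\mathcal{D}A$. $MA$ is the MacNeille completion of $A$, viewed as the complete lattice (under inclusion) of normal ideals of $A$; a normal ideal is a subset $E\subseteq A$ equal to the set of lower bounds of the set of upper bounds of $E$ (equivalently, an intersection of principal ideals ${\downarrow}a$). A subset $G\subseteq A$ is admissible if $\bigvee G$ exists in $A$ and for each $a\in A$ the join $\bigvee\{a\wedge y: y\in G\}$ exists and equals $a\wedge\bigvee G$. A downset $E$ of $A$ is a D-ideal if $\bigvee G\in E$ for each admissible $G\subseteq E$. $D_\infty A$ is the set of D-ideals, ordered by inclusion. For $E\in\mathcal{D}A$, $\delta(E)=\{\bigvee G: G\subseteq E \text{ is admissible}\}$. The map $k^A_{\mathcal{D}A}:\mathcal{D}A\to\mathcal{D}A$ is $k(E)=\bigcap\{{\downarrow}a: a\in A,\ E\subseteq{\downarrow}a\}$, with set of fixpoints $\mathrm{fix}(k)$. The map $j^A_{\mathcal{D}A}$ is $j(E)=\bigcap\{(E\to C)\to C: C\in \mathrm{fix}(k)\}$, where $\to$ is the Heyting implication of $\mathcal{D}A$.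 For $a,b\in A$, $\langle a,b\rangle=\{x\in A: a\wedge x\le b\}$. *)

(* Defs.v *)
From HB Require Import structures.
From mathcomp Require Import all_boot all_order.
From mathcomp Require Import boolp classical_sets.

Set Implicit Arguments.
Unset Strict Implicit.
Unset Printing Implicit Defensive.

Import Order.TTheory.
Local Open Scope order_scope.
Local Open Scope classical_set_scope.

(* Joins and meets of arbitrary subsets are relational: [supremums S s] says
   that [s] is the least upper bound of [S]; [infimums] is dual. *)

Definition complete_lattice d (L : porderType d) : Prop :=
  (forall S : set L, supremums S !=set0) /\
  (forall S : set L, infimums S !=set0).

(* Second conjunct: a /\ \/S = \/ {a /\ y | y in S}. *)
Definition is_frame d (L : porderType d) : Prop :=
  complete_lattice L /\
  forall (a : L) (S : set L) (s m : L),
    supremums S s -> infimums [set a; s] m ->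
    supremums [set z | exists2 y, S y & infimums [set a; y] z] m.

(* A family of subsets of T, as a poset ordered by inclusion (the order of
   [set T], see [subsetEset]). *)
Definition incl_poset (T : Type) (F : set (set T)) : Type := set_type F.

HB.instance Definition _ (T : Type) (F : set (set T)) :=
  SubChoice.on (incl_poset F).
HB.instance Definition _ (T : Type) (F : set (set T)) :=
  [SubChoice_isSubPOrder of incl_poset F by <: with set_display].

Section MeetSemilattice.
Context {d : Order.disp_t} {A : meetSemilatticeType d}.
Implicit Types (a b x y : A) (E C G : set A).

Definition pideal a : set A := [set x | x <= a].

Definition is_downset E : Prop := forall x y, x <= y -> E y -> E x.

Definition normal_ideal E : Prop := E = lbound (ubound E).

(* The family may be empty, in which case it exhibits the ideal A. *)
Lemma normal_idealP E :
  normal_ideal E <-> exists S : set A, E = \bigcap_(a in S) pideal a.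
Proof.
have lbE (S : set A) : lbound S = \bigcap_(a in S) pideal a by [].
split=> [->|[S ->]]; first by exists (ubound E).
rewrite /normal_ideal -lbE; apply/seteqP; split=> x.
- by move=> Sx u; apply.
- by move=> Sx a Sa; apply: Sx => y; apply.
Qed.

Definition admissible G : Prop :=
  exists2 g, supremums G g &
    forall a, supremums [set Order.meet a y | y in G] (Order.meet a g).

Definition D_ideal E : Prop :=
  is_downset E /\
  forall G g, G `<=` E -> admissible G -> supremums G g -> E g.

(* The relative annihilator <a, b>. *)
Definition relann a b : set A := [set x | Order.meet a x <= b].

End MeetSemilattice.

Section Completions.
Context {d : Order.disp_t} (A : meetSemilatticeType d).

Definition MacNeille : set (set A) := [set E | normal_ideal E].

Definition Dinf : set (set A) := [set E | D_ideal E].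

Definition downsets : set (set A) := [set E | is_downset E].

End Completions.

Arguments MacNeille {d} A.
Arguments Dinf {d} A.
Arguments downsets {d} A.

Section Operators.
Context {d : Order.disp_t} {A : meetSemilatticeType d}.
Local Notation DA := (incl_poset (downsets A)).
Implicit Types (E C D : DA) (X : set A).

Definition mkDownset X (hX : is_downset X) : DA :=
  exist _ X (mem_set hX).

Lemma downsetP E : is_downset (val E).
Proof. exact: (set_mem (valP E)). Qed.
Arguments downsetP : clear implicits.

Lemma pideal_downset (a : A) : is_downset (pideal a).
Proof. by move=> x y; exact: le_trans. Qed.
Arguments pideal_downset : clear implicits.

Lemma bigcap_downset I (P : set I) (F : I -> set A) :
  (forall i, P i -> is_downset (F i)) -> is_downset (\bigcap_(i in P) F i).
Proof. by move=> dF x y xy Fy i Pi; apply: (dF i Pi _ _ xy); exact: Fy. Qed.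

Lemma bigcup_downset I (P : set I) (F : I -> set A) :
  (forall i, P i -> is_downset (F i)) -> is_downset (\bigcup_(i in P) F i).
Proof. by move=> dF x y xy [i Pi Fy]; exists i => //; exact: dF xy Fy. Qed.

(* The Heyting implication E -> C, as the join of all D with D /\ E <= C. *)
Definition himp E C : DA :=
  mkDownset (@bigcup_downset _ [set D | val D `&` val E `<=` val C] val
    (fun D _ => downsetP D)).

Lemma himpP D E C : (D <= himp E C) <-> (val D `&` val E `<=` val C).
Proof.
rewrite -Order.le_val subsetEset; split=> [DEC x [Dx Ex]|DEC x Dx]; last by exists D.
by have [D' D'EC D'x] := DEC x Dx; exact: D'EC.
Qed.

Definition kop E : DA :=
  mkDownset (@bigcap_downset _ [set a | val E `<=` pideal a] pideal
    (fun a _ => pideal_downset a)).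

Definition fixk : set (DA) := [set C | kop C = C].

Definition jop E : DA :=
  mkDownset (@bigcap_downset _ fixk (fun C => val (himp (himp E C) C))
    (fun C _ => downsetP (himp (himp E C) C))).

Definition delta_set E : set A :=
  [set g | exists G, [/\ G `<=` val E, admissible G & supremums G g]].

Lemma delta_downset E : is_downset (delta_set E).
Proof.
move=> x y xy [G [GE [g Gg adG] Gy]].
have gy : g = y by exact: (is_subset1_supremums Gg Gy).
have xg : Order.meet x g = x by rewrite gy; exact/meet_idPl.
exists [set Order.meet x z | z in G]; split.
- by move=> _ [z Gz <-]; apply: (downsetP E _ _ (leIr z x)); exact: GE.
- exists x; first by rewrite -{2}xg; exact: adG.
  move=> a; have := adG (Order.meet a x); rewrite -meetA xg.
  congr (supremums _ _); apply/seteqP; split=> _ [z Gz <-].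
  + by exists (Order.meet x z); [exists z | rewrite meetA].
  + by move: Gz => [t Gt <-]; exists t => //; rewrite meetA.
- by rewrite -{2}xg; exact: adG.
Qed.

Definition delta E : DA := mkDownset (@delta_downset E).

End Operators.

(* Main.v *)
Require Import Defs.
From mathcomp Require Import all_boot all_order.
From mathcomp Require Import boolp classical_sets.

(** Write [cl X] for [lbound (ubound X)], the normal ideal generated by [X].
    Everything turns on how [cl E] compares with [delta E], for a downset [E].

    The key is that membership in [delta E] can be tested on [E] itself: [x]
    is the join of an admissible subset of [E] exactly when every [z <= x] is
    the join of the [z /\ y] with [y] in [E] ([delta_setP]).  Two consequences
    hold in every meet-semilattice: [delta E] is a D-ideal
    ([delta_set_D_ideal]), and [delta <= j <= k] ([delta_sub_jop],
    [jop_sub_kop]).  Normal ideals are always D-ideals, since they are closed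
    under all existing joins.

    - If [MA] is a frame and [x] is in [cl E], then distributing the principal
      ideal of [z <= x] over [cl E], the join in [MA] of the principal ideals
      below [E], shows that [z] is the join of the [z /\ y].  So
      [cl E = delta E], which is contained in [E] when [E] is a D-ideal.
    - If every D-ideal is normal, then [delta E] is normal; it contains [E],
      hence it contains [k E], and the chain [delta <= j <= k] collapses.
    - If [k = delta], then relative annihilators are normal, because the
      admissible joins that define [delta] are preserved by [a /\ _].
    - If relative annihilators are normal, then normal ideals contained in
      [<x, b>] have their join in [MA] contained in [<x, b>] too.  This is the
      frame law: binary meets in [MA] are intersections and every bound is an
      intersection of principal ideals, so the law may be checked at one
      element [x] of the left factor and one principal bound [b] at a time. *)

Set Implicit Arguments.
Unset Strict Implicit.
Unset Printing Implicit Defensive.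

Import Order.TTheory.
Local Open Scope order_scope.
Local Open Scope classical_set_scope.

(** * Normal ideals *)

Section Closure.
Context {d : Order.disp_t} {A : meetSemilatticeType d}.
Implicit Types (a b x y z : A) (E G N X : set A).

Lemma sub_lbound_ubound X : X `<=` lbound (ubound X).
Proof. by move=> x Xx u; apply. Qed.

Lemma normal_ideal_min X N :
  normal_ideal N -> X `<=` N -> lbound (ubound X) `<=` N.
Proof.
by move=> -> XN x xX u uN; apply: xX => y /XN; apply.
Qed.

Lemma normal_idealI X : lbound (ubound X) `<=` X -> normal_ideal X.
Proof. by move=> clX; apply/seteqP; split=> //; exact: sub_lbound_ubound. Qed.

Lemma normal_lbound_ubound X : normal_ideal (lbound (ubound X)).
Proof.
apply: normal_idealI => x clx u uX; apply: clx => y; exact.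
Qed.

Lemma normal_pideal a : normal_ideal (pideal a).
Proof. by apply: normal_idealI => x; apply=> y. Qed.

Lemma normal_bigcap I (P : set I) (F : I -> set A) :
  (forall i, P i -> normal_ideal (F i)) -> normal_ideal (\bigcap_(i in P) F i).
Proof.
move=> nF; apply: normal_idealI => x clx i Pi.
by apply: (normal_ideal_min (nF i Pi) _ clx) => y; apply.
Qed.

Lemma normal_setI E N :
  normal_ideal E -> normal_ideal N -> normal_ideal (E `&` N).
Proof.
move=> nE nN; apply: normal_idealI => x clx.
by split; [apply: (normal_ideal_min nE _ clx)
          | apply: (normal_ideal_min nN _ clx)] => y [].
Qed.

Lemma normal_downset N : normal_ideal N -> is_downset N.
Proof. by move=> -> x y xy clNy u uN; apply: le_trans xy (clNy u uN). Qed.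

Lemma normal_supremum N G g :
  normal_ideal N -> G `<=` N -> supremums G g -> N g.
Proof. by move=> nN GN [_ Gg]; exact: (normal_ideal_min nN GN). Qed.

Lemma normal_D_ideal N : normal_ideal N -> D_ideal N.
Proof.
move=> nN; split; first exact: normal_downset.
by move=> G g GN _; exact: normal_supremum.
Qed.

End Closure.

(** * Admissible joins and the chain delta <= j <= k *)

Section Delta.
Context {d : Order.disp_t} {A : meetSemilatticeType d}.
Local Notation DA := (incl_poset (downsets A)).
Implicit Types (a x y z : A) (E : DA) (G X : set A).

Lemma admissible_supremum G g a :
  admissible G -> supremums G g ->
  supremums [set Order.meet a y | y in G] (Order.meet a g).
Proof.
by case=> h Gh dG Gg; rewrite (is_subset1_supremums Gg Gh).
Qed.

(** The admissible set witnessing [delta_set E x] may always be taken to be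
    [{x /\ y | y in E}]: it lies in [E] because [E] is a downset, and any
    admissible subset of [E] with join [x] is contained in it.  Admissibility
    then says that the elements [z = a /\ x] below [x] are joins as stated.
    Since [z] is always an upper bound of the [z /\ y], saying that it is their
    join amounts to the implication on the right-hand side. *)
Lemma delta_setP E x :
  delta_set E x <->
  forall z u, z <= x -> (forall y, val E y -> Order.meet z y <= u) -> z <= u.
Proof.
split=> [[G [GE adG Gx]] z u zx zEu|xE].
  have [_ leu] := admissible_supremum z adG Gx.
  rewrite -(meet_idPl zx); apply: leu => _ [y Gy <-].
  exact/zEu/GE.
have supE a :
  supremums [set Order.meet a t | t in [set Order.meet x y | y in val E]]
    (Order.meet a x).
  split=> [_ [_ [y _ <-] <-]|u uE]; first by rewrite meetA leIl.
  apply: xE => [|y Ey]; first exact: leIr.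
  by rewrite -meetA; apply: uE; exists (Order.meet x y) => //; exists y.
have supx : supremums [set Order.meet x y | y in val E] x.
  split=> [_ [y _ <-]|u uE]; first exact: leIl.
  by apply: xE => // y Ey; apply: uE; exists y.
exists [set Order.meet x y | y in val E]; split=> //; last by exists x.
by move=> _ [y Ey <-]; exact: (downsetP (leIr _ _) Ey).
Qed.

Lemma sub_delta_set E : val E `<=` delta_set E.
Proof.
by move=> x Ex; apply/delta_setP => z u zx /(_ x Ex); rewrite (meet_idPl zx).
Qed.

(** Joins of admissible joins are again tested on [E]: for [z] below [g],
    distribute [z] first over [G], then each [z /\ y] over [E]. *)
Lemma delta_set_D_ideal E : D_ideal (delta_set E).
Proof.
split=> [|G g GE adG Gg]; first exact: delta_downset.
apply/delta_setP => z u zg zEu.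
have [_ leu] := admissible_supremum z adG Gg.
rewrite -(meet_idPl zg); apply: leu => _ [y Gy <-].
move/delta_setP: (GE y Gy); apply=> [|t Et]; first exact: leIr.
by apply: le_trans (zEu t Et); apply: leI2 => //; exact: leIl.
Qed.

Lemma D_ideal_delta X (dX : is_downset X) :
  D_ideal X -> delta_set (mkDownset dX) `<=` X.
Proof. by move=> [_ clX] x [G [GX adG Gx]]; exact: clX GX adG Gx. Qed.

Lemma kopE E : val (kop E) = lbound (ubound (val E)).
Proof. by []. Qed.

Lemma fixk_normal (C : DA) : fixk C -> normal_ideal (val C).
Proof. by move=> kC; rewrite /normal_ideal -kopE kC. Qed.

Lemma normal_fixk (C : DA) : normal_ideal (val C) -> fixk C.
Proof. by move=> nC; apply: val_inj; rewrite kopE -nC. Qed.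

Lemma himpE (E C : DA) x :
  val (himp E C) x <-> forall y, y <= x -> val E y -> val C y.
Proof.
split=> [[D DEC Dx] y yx Ey|xEC].
  by apply: DEC; split=> //; exact: (downsetP yx Dx).
exists (mkDownset (pideal_downset (a := x))); last exact: lexx.
by move=> y [yx Ey]; exact: xEC.
Qed.

(** An admissible join [x] of elements of [E] is forced into [C] as soon as
    [E] is: an element [z <= x] of [E -> C] is the join of elements [z /\ y],
    which lie in both [E] and [E -> C], hence in the normal ideal [C]. *)
Lemma delta_sub_jop E : delta_set E `<=` val (jop E).
Proof.
move=> x /delta_setP xE C /fixk_normal nC; apply/himpE => z zx /himpE zEC.
rewrite nC => u uC; apply: xE zx _ => y Ey.
by apply: uC; apply: zEC (leIl _ _) _; exact: (downsetP (leIr _ _) Ey).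
Qed.

(** Take [C = k E] in the intersection defining [j E]: then [E -> C] is the
    whole of [A], so [(E -> C) -> C] is [C]. *)
Lemma jop_sub_kop E : val (jop E) `<=` val (kop E).
Proof.
move=> x jEx.
have fE : fixk (kop E) by apply: normal_fixk; exact: normal_lbound_ubound.
have /himpE xk := jEx _ fE; apply: (xk x (lexx x)); apply/himpE => y _ Ey.
exact: sub_lbound_ubound Ey.
Qed.

End Delta.
Arguments D_ideal_delta {d A X} dX.

(** * The MacNeille completion *)

Section MacNeille.
Context {d : Order.disp_t} {A : meetSemilatticeType d}.
Local Notation MA := (incl_poset (MacNeille A)).
Implicit Types (a x y z : A) (E F N : MA) (S : set MA).

Definition mkNormal (X : set A) (nX : normal_ideal X) : MA :=
  exist _ X (mem_set nX).

Lemma MacNeille_normal N : normal_ideal (val N).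
Proof. exact: (set_mem (valP N)). Qed.

Lemma MacNeille_leP E N : E <= N <-> val E `<=` val N.
Proof. by rewrite -Order.le_val subsetEset. Qed.

Lemma MacNeille_complete : complete_lattice MA.
Proof.
split=> S.
  exists (mkNormal (normal_lbound_ubound (\bigcup_(E in S) val E))).
  split=> [E SE|N SN]; apply/MacNeille_leP.
    by apply: subset_trans (@sub_lbound_ubound _ _ _) => x; exists E.
  apply: normal_ideal_min; first exact: MacNeille_normal.
  by move=> x [E /SN/MacNeille_leP]; apply.
exists (mkNormal (normal_bigcap (P := S) (fun E _ => MacNeille_normal E))).
split=> [E SE|N SN]; apply/MacNeille_leP; first by move=> x; apply.
by move=> x Nx E /SN/MacNeille_leP; apply.
Qed.

Definition MacNeille_meet E F : MA :=
  mkNormal (normal_setI (MacNeille_normal E) (MacNeille_normal F)).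

Lemma MacNeille_meet_infimum E F : infimums [set E; F] (MacNeille_meet E F).
Proof.
split=> [_ [->|->]|N NEF]; apply/MacNeille_leP; [by move=> x []..|].
have /MacNeille_leP NE : N <= E by apply: NEF; left.
have /MacNeille_leP NF : N <= F by apply: NEF; right.
by move=> x Nx; split; [exact: NE | exact: NF].
Qed.

Lemma MacNeille_meetE E F N :
  infimums [set E; F] N -> val N = val E `&` val F.
Proof.
by move=> infN; rewrite (is_subset1_infimums infN (MacNeille_meet_infimum E F)).
Qed.

(** The normal ideal generated by [X] is the join in [MA] of the principal
    ideals of its elements.  Distributing the principal ideal of [x] over this
    join gives the join of the principal ideals of the [x /\ y]; comparing it
    with that of [u] brings the conclusion back to [A]. *)
Lemma frame_distr (X : set A) x u :
  is_frame MA -> lbound (ubound X) x ->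
  (forall y, X y -> Order.meet x y <= u) -> x <= u.
Proof.
move=> [_ distr] clx xXu.
pose pid a : MA := mkNormal (normal_pideal a).
pose s := mkNormal (normal_lbound_ubound X).
have sup_s : supremums [set pid y | y in X] s.
  split=> [_ [y Xy <-]|N XN]; apply/MacNeille_leP.
    by move=> z zy v vX; exact: le_trans zy (vX y Xy).
  apply: normal_ideal_min; first exact: MacNeille_normal.
  move=> y Xy; have /MacNeille_leP : pid y <= N by apply: XN; exists y.
  by apply; exact: lexx.
have xs : pid x <= s.
  by apply/MacNeille_leP => z zx v vX; exact: le_trans zx (clx v vX).
have inf_x : infimums [set pid x; s] (pid x).
  by split=> [_ [->|->] //|N]; apply; left.
have [_ lex] := distr _ _ _ _ sup_s inf_x.
suff /MacNeille_leP : pid x <= pid u by apply; exact: lexx.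
apply: lex => N [_ [y Xy <-] /MacNeille_meetE NE].
apply/MacNeille_leP; rewrite NE => z [zx zy].
by apply: le_trans (xXu y Xy); rewrite lexI; apply/andP.
Qed.

(** * The cycle of implications *)

Lemma frame_Dinf : is_frame MA -> MacNeille A = Dinf A.
Proof.
move=> frA; apply/seteqP; split=> [E|E DE]; first exact: normal_D_ideal.
apply: normal_idealI => x clx; have dE := DE.1.
apply: (D_ideal_delta dE DE).
apply/delta_setP => z u zx; apply: frame_distr => // v vE.
exact: le_trans zx (clx v vE).
Qed.

Lemma Dinf_kop_jop_delta :
  MacNeille A = Dinf A ->
  (@kop d A = @jop d A) /\ (@jop d A = @delta d A).
Proof.
move=> MD; have kdelta (E : incl_poset (downsets A)) :
    val (kop E) `<=` delta_set E.
  apply: normal_ideal_min (@sub_delta_set _ _ E).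
  have : Dinf A (delta_set E) by exact: delta_set_D_ideal.
  by rewrite -MD.
split; apply/funext => E; apply/val_inj/seteqP; split.
- by move=> x /kdelta; exact: delta_sub_jop.
- exact: jop_sub_kop.
- by move=> x /jop_sub_kop/kdelta.
- exact: delta_sub_jop.
Qed.

Lemma relann_downset (a b : A) : is_downset (relann a b).
Proof. by move=> x y xy; apply: le_trans; exact: leI2. Qed.

(** Admissible joins are the joins that every [a /\ _] preserves, so a bound
    [b] on the elements [a /\ y] passes to [a /\ \/ y]. *)
Lemma relann_D_ideal (a b : A) : D_ideal (relann a b).
Proof.
split=> [|G g Gab adG Gg]; first exact: relann_downset.
have [_ leb] := admissible_supremum a adG Gg.
by apply: leb => _ [y /Gab ? <-].
Qed.

Lemma kop_delta_relann :
  @kop d A = @delta d A -> forall a b : A, normal_ideal (relann a b).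
Proof.
move=> kd a b; have dab := relann_downset (a := a) (b := b).
apply: normal_idealI; rewrite -(kopE (mkDownset dab)) kd.
exact: (D_ideal_delta dab (relann_D_ideal a b)).
Qed.

Lemma relann_frame :
  (forall a b : A, normal_ideal (relann a b)) -> is_frame MA.
Proof.
move=> nab; split; first exact: MacNeille_complete.
move=> E S s m [ub_s min_s] /MacNeille_meetE mE; split.
  move=> N [F SF /MacNeille_meetE NE]; apply/MacNeille_leP.
  have /MacNeille_leP Fs : F <= s by exact: ub_s.
  by rewrite NE mE; exact: setIS.
move=> N ubN; apply/MacNeille_leP; rewrite mE => x [Ex sx].
rewrite (MacNeille_normal N) => b bN.
(* It suffices that [s] lies in [<x, b>], since [x] is in [s]. *)
have /MacNeille_leP s_xb : s <= mkNormal (nab x b).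
  apply: min_s => F SF; apply/MacNeille_leP => y Fy.
  have /MacNeille_leP EFN : MacNeille_meet E F <= N.
    by apply: ubN; exists F => //; exact: MacNeille_meet_infimum.
  apply: bN; apply: EFN; split.
  - exact: (normal_downset (MacNeille_normal E) (leIl _ _) Ex).
  - exact: (normal_downset (MacNeille_normal F) (leIr _ _) Fy).
by have := s_xb x sx; rewrite /= /relann /= meetxx.
Qed.

End MacNeille.

Theorem theorem3p15 (d : Order.disp_t) (A : meetSemilatticeType d) :
  [<-> is_frame (incl_poset (MacNeille A));
       MacNeille A = Dinf A;
       (@kop d A = @jop d A) /\ (@jop d A = @delta d A);
       forall a b : A, normal_ideal (relann a b)].
Proof.
tfae.
- exact: frame_Dinf.
- exact: Dinf_kop_jop_delta.
- by case=> kj jdelta; apply: kop_delta_relann; rewrite kj.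
- exact: relann_frame.
Qed.
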